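(* Let $\mu$ be a (non-zero) finite Borel measure on $\mathbb{R}^d$ and $\theta\in(0,1]$. If $\underline{F}_\mu(\theta)<\theta d$, then \[ \dim_{\mathrm F}^{\theta}\mu=\underline{F}_\mu(\theta). \]
   Context: For a finite Borel measure $\mu$ on $\mathbb{R}^d$ write $\widehat\mu(z)=\int e^{-2\pi i z\cdot x}\,d\mu(x)$. For $s\geq 0$ and $\theta\in(0,1]$ let $\mathcal{J}_{s,\theta}(\mu)=\left(\int_{\mathbb{R}^d}|\widehat\mu(z)|^{2/\theta}|z|^{s/\theta-d}\,dz\right)^{\theta}$. The Fourier spectrum of $\mu$ at $\theta$ is $\dim_{\mathrm F}^{\theta}\mu=\sup\{s\geq 0:\mathcal{J}_{s,\theta}(\mu)<\infty\}\in[0,\infty]$, with $\sup\emptyset=0$. For $\theta\in(0,1]$, \[ \underline{F}_\mu(\theta)=\liminf_{R\to\infty}\frac{\theta\log\left(R^{-d}\int_{|z|\leq R}|\widehat\mu(z)|^{2/\theta}\,dz\right)}{-\log R}. \] *)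

(* Defs.v *)
From HB Require Import structures.
From mathcomp Require Import all_boot all_order all_algebra.
From mathcomp Require Import all_classical all_reals all_analysis.
From mathcomp Require Import complex.

Set Implicit Arguments.
Unset Strict Implicit.
Unset Printing Implicit Defensive.

Import Order.TTheory GRing.Theory Num.Theory.
Import numFieldNormedType.Exports.

Local Open Scope classical_set_scope.
Local Open Scope ring_scope.

Local Notation normc := ComplexField.Normc.normc.

(* R^d.  The sigma-algebra carried by tuples is the one generated by the
   coordinate maps, i.e. the d-fold product of the Borel sigma-algebra of R;
   by second countability it is the Borel sigma-algebra of R^d. *)
Notation euclid R d := (d.-tuple (measurableTypeR R))%type.

Section euclidean_structure.
Context {R : realType} {d : nat}.
Implicit Types x y : euclid R d.

Definition edot x y : R := \sum_(i < d) (tnth x i : R) * (tnth y i : R).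

Definition enorm x : R := Num.sqrt (edot x x).

End euclidean_structure.

Section euclid_lebesgue.
Context {R : realType}.

Definition euclid_cons {n} (p : (measurableTypeR R * euclid R n)%type) :
  euclid R n.+1 := [tuple of p.1 :: p.2].

Fixpoint euclid_lebesgue (n : nat) : set (euclid R n) -> \bar R :=
  match n with
  | 0%N => dirac [tuple]
  | m.+1 => pushforward (lebesgue_measure \x @euclid_lebesgue m)%E euclid_cons
  end.
Arguments euclid_lebesgue n : clear implicits.

Lemma measurable_euclid_cons n : measurable_fun [set: _] (@euclid_cons n).
Proof. exact: measurable_cons. Qed.

Section step.
Variables (n : nat) (m : {sigma_finite_measure set (euclid R n) -> \bar R}).

Let step := pushforward (lebesgue_measure \x m)%E (@euclid_cons n).

Let step0 : step set0 = 0%E.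
Proof. by rewrite /step /pushforward preimage_set0 measure0. Qed.

Let step_ge0 A : (0 <= step A)%E.
Proof. by rewrite /step /pushforward; exact: measure_ge0. Qed.

Let step_sigma_additive : semi_sigma_additive step.
Proof.
exact: (@measure_semi_sigma_additive _ _ _
  (measure_function_pushforward__canonical__measure_function_Measure
    (lebesgue_measure \x m)%E (@measurable_euclid_cons n))).
Qed.

HB.instance Definition _ :=
  isMeasure.Build _ _ _ step step0 step_ge0 step_sigma_additive.

Let step_sigma_finite : sigma_finite [set: euclid R n.+1] step.
Proof.
have /sigma_finiteP[F [TF ndF mF]] := sigma_finiteT (@lebesgue_measure R).
have /sigma_finiteP[G [TG ndG mG]] := sigma_finiteT m.
pose g (t : euclid R n.+1) : (measurableTypeR R * euclid R n)%type :=
  (tnth t ord0, [tuple of behead t]).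
have mg : measurable_fun [set: euclid R n.+1] g.
  apply/measurable_fun_pair; first exact: measurable_tnth.
  exact: measurable_behead.
have gK p : g (euclid_cons p) = p.
  by case: p => a t; congr pair; apply/val_inj.
exists (fun k => g @^-1` (F k `*` G k)) => [|k].
  rewrite -preimage_bigcup (_ : \bigcup_k _ = setT) ?preimage_setT//.
  apply/seteqP; split => // -[x y] _.
  have [i _ Fix] : (\bigcup_k F k) x by rewrite -TF.
  have [j _ Gjy] : (\bigcup_k G k) y by rewrite -TG.
  exists (maxn i j) => //; split => /=.
  - by move: x Fix; exact/subsetPset/ndF/leq_maxl.
  - by move: y Gjy; exact/subsetPset/ndG/leq_maxr.
have [mFk Fk] := mF k; have [mGk Gk] := mG k; split.
  by rewrite -[X in measurable X]setTI; apply: mg => //; exact: measurableX.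
rewrite /step /pushforward -comp_preimage (_ : g \o _ = id).
  by rewrite preimage_id product_measure1E// lte_mul_pinfty// ge0_fin_numE.
by apply/funext => p; exact: gK.
Qed.

HB.instance Definition _ :=
  Measure_isSigmaFinite.Build _ _ _ step step_sigma_finite.

Lemma euclid_lebesgue_step :
  exists m' : {sigma_finite_measure set (euclid R n.+1) -> \bar R},
    m' = step :> (set _ -> \bar R).
Proof. by exists step. Qed.

End step.

Lemma euclid_lebesgue_measure n :
  exists m : {sigma_finite_measure set (euclid R n) -> \bar R},
    m = euclid_lebesgue n :> (set _ -> \bar R).
Proof.
elim: n => [|n [m IH]] /=; first by exists (dirac [tuple]).
by rewrite -IH; exact: euclid_lebesgue_step.
Qed.

Let euclid_lebesgue0 n : euclid_lebesgue n set0 = 0%E.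
Proof. by have [m <-] := euclid_lebesgue_measure n. Qed.

Let euclid_lebesgue_ge0 n A : (0 <= euclid_lebesgue n A)%E.
Proof. by have [m <-] := euclid_lebesgue_measure n. Qed.

Let euclid_lebesgue_additive n : semi_sigma_additive (euclid_lebesgue n).
Proof.
have [m <-] := euclid_lebesgue_measure n.
exact: measure_semi_sigma_additive.
Qed.

HB.instance Definition _ n := isMeasure.Build _ _ _ (euclid_lebesgue n)
  (euclid_lebesgue0 n) (@euclid_lebesgue_ge0 n) (@euclid_lebesgue_additive n).

Let euclid_lebesgue_sigma_finite n :
  sigma_finite [set: euclid R n] (euclid_lebesgue n).
Proof.
have [m <-] := euclid_lebesgue_measure n.
exact: (sigma_finiteT m).
Qed.

HB.instance Definition _ n := Measure_isSigmaFinite.Build _ _ _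
  (euclid_lebesgue n) (@euclid_lebesgue_sigma_finite n).

Lemma euclid_lebesgue_box n (A : 'I_n -> set (measurableTypeR R)) :
  (forall i, measurable (A i)) ->
  euclid_lebesgue n [set x | forall i, A i (tnth x i)] =
  (\prod_(i < n) lebesgue_measure (A i))%E.
Proof.
elim: n A => [|n IH] A mA.
  by rewrite big_ord0 /= diracE (_ : [set _ | _] = setT) ?in_setT//;
    apply/seteqP; split => // x _ [].
rewrite big_ord_recl -IH => [|i]; last exact: mA.
rewrite -product_measure1E; [|exact: mA|]; last first.
  rewrite [X in measurable X](_ : _ =
    \bigcap_(i in [set: 'I_n]) [set x | A (lift ord0 i) (tnth x i)]);
      last first.
    by apply/seteqP; split => x /= h i => [_|]; exact: h.
  apply: fin_bigcap_measurable => // i _; rewrite -[X in measurable X]setTI.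
  exact: (@measurable_tnth _ _ n i measurableT _ (mA _)).
rewrite /= /pushforward; congr (product_measure1 _ _ _).
apply/seteqP; split => -[a t] /= h.
  split; first exact: (h ord0).
  by move=> i; have := h (lift ord0 i); rewrite tnthS.
by case: h => h0 h i; case: (unliftP ord0 i) => [j ->|->//]; rewrite tnthS.
Qed.

End euclid_lebesgue.
Arguments euclid_lebesgue {R} n.

Section fourier_spectrum.
Context {R : realType} {d : nat}.
Variable mu : {finite_measure set (euclid R d) -> \bar R}.

Definition cexpi (t : R) : R[i] := Complex (cos t) (sin t).

Definition Cintegral (f : euclid R d -> R[i]) : R[i] :=
  Complex (\int[mu]_x complex.Re (f x)) (\int[mu]_x complex.Im (f x)).

Definition fourier (z : euclid R d) : R[i] :=
  Cintegral (fun x => cexpi (- (2 * pi * edot z x))).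

(* 0 `^ a is 0 for a != 0, so the integrand at z = 0 differs from the textbook
   value when the exponent is negative; this is a null set as soon as d > 0. *)
Definition fourier_energy (s theta : R) : \bar R :=
  poweR (\int[euclid_lebesgue d]_z
    (normc (fourier z) `^ (2 / theta) * enorm z `^ (s / theta - d%:R))%:E)%E
    theta.

(* The maximum with 0 encodes the convention sup set0 = 0, as ereal_sup set0 is
   -oo. *)
Definition fourier_spectrum (theta : R) : \bar R :=
  maxe 0%E (ereal_sup
    [set s%:E | s in [set s : R | 0 <= s /\ (fourier_energy s theta < +oo)%E]]).

(* The logarithm is extended by log 0 = -oo. *)
Definition lower_F (theta : R) : \bar R :=
  limf_einf (fun r : R =>
    theta%:E *
      lne ((r ^- d)%:E *
        \int[euclid_lebesgue d]_(z in [set z | (enorm z <= r)%R])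
          (normc (fourier z) `^ (2 / theta))%:E) / (- ln r)%:E)%E
    (pinfty_nbhs R).

End fourier_spectrum.

(* Main.v *)
(* Write f = |mu^|^(2/theta), which is bounded, and I(r) for its integral over
   the ball of radius r; then lower_F is theta times the lower decay rate of
   r^-d I(r), and energies of mu are moments of f against |z|^p with
   p = s/theta - d.  If the moment is finite and p <= 0, then
   I(r) <= r^-p * moment, so s <= lower_F; if p > 0, f is integrable and
   lower_F >= theta d, which is excluded.  Conversely, if s < t < lower_F, then
   I(r) <= r^(d - t/theta) for large r, and cutting R^d into dyadic shells bounds
   the moment by two geometric series: near infinity with ratio
   2^((s-t)/theta), and near the origin, where I(r) = O(r^d), with ratio
   2^(-s/theta). *)
Require Import Defs.
From mathcomp Require Import all_boot all_order all_algebra.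
From mathcomp Require Import all_classical all_reals all_analysis.
From mathcomp Require Import measurable_realfun complex ring lra.

Set Implicit Arguments.
Unset Strict Implicit.
Unset Printing Implicit Defensive.

Import Order.TTheory GRing.Theory Num.Theory.
Import numFieldNormedType.Exports.

Local Open Scope classical_set_scope.
Local Open Scope ring_scope.

(** * Decay rates at infinity as power bounds *)

Section growth.
Context {R : realType}.
Implicit Types (v : \bar R) (r t theta u K : R).

(** For [r > 1] one divides by [- ln r < 0], which reverses the inequality. The conventions fit: if
    [v <= 0], then [lne v] is -oo, the quotient is +oo and both sides hold; if [v = +oo], both
    fail. *)
Lemma le_decay_rate r t theta v : 1 < r -> 0 < theta ->
  (t%:E <= theta%:E * lne v / (- ln r)%:E)%E =
  (v <= (r `^ (- (t / theta)))%:E)%E.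
Proof.
move=> r1 th0; have lr0 : 0 < ln r by rewrite ln_gt0.
have r0 : 0 < r by lra.
have nlr : - ln r != 0 by rewrite oppr_eq0 gt_eqF.
rewrite inver (negbTE nlr) muleC.
have nlr0 : (- ln r)^-1 < 0 by rewrite invr_lt0 oppr_lt0.
have vNy : (((- ln r)^-1)%:E * (theta%:E * -oo) = +oo :> \bar R)%E.
  by rewrite gt0_muleNy ?lte_fin// lt0_muleNy ?lte_fin.
case: v => [v||].
- have [v0|v0] := leP v 0.
    rewrite le0_lneNy ?lee_fin// vNy leey; apply/esym.
    by rewrite (le_trans v0)// powR_ge0.
  rewrite lne_EFin// -!EFinM !lee_fin -[RHS]ler_ln ?posrE ?powR_gt0// ln_powR.
  rewrite mulrC invrN mulrN lerNr ler_pdivrMr//.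
  have -> : - (t / theta) * ln r = - t * ln r / theta.
    by field; rewrite gt_eqF.
  by rewrite ler_pdivlMr// [theta * _]mulrC.
- by rewrite [lne _]/= gt0_muley ?lte_fin// lt0_muley ?lte_fin.
- by rewrite [lne _]/= vNy leey leNye.
Qed.

Section rate.
Variables (d : nat) (theta : R) (I : R -> \bar R).
Hypothesis theta_gt0 : 0 < theta.

Local Notation rate :=
  (fun r => theta%:E * lne ((r ^- d)%:E * I r) / (- ln r)%:E)%E.

Lemma le_normalized r t : 0 < r ->
  ((r ^- d)%:E * I r <= (r `^ t)%:E)%E = (I r <= (r `^ (d%:R + t))%:E)%E.
Proof.
move=> r0; rewrite powRD ?(gt_eqF r0) ?implybT// powR_mulrn ?(ltW r0)// EFinM.
by rewrite lee_pdivrMl ?exprn_gt0.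
Qed.

(** The constant [K] does not affect the rate: giving up [e] in the rate gains a factor
    [r ^ (e / theta)], which eventually exceeds [K]. *)
Lemma lower_rate_ge K u : 0 < K ->
  (\forall r \near +oo%R, I r <= (K * r `^ (d%:R - u))%:E)%E ->
  ((theta * u)%:E <= limf_einf rate (pinfty_nbhs R))%E.
Proof.
move=> K0 IK; apply/lee_addgt0Pr => e e0.
rewrite -leeBlDr// -EFinB limf_einfE; apply: le_ereal_sup_tmp.
pose V := [set r | (theta * u - e)%:E <= rate r]%E.
exists (ereal_inf (rate @` V)); last first.
  by apply: le_ereal_inf_tmp => _ [r Vr <-]; exact: Vr.
exists V => //; near=> r; rewrite /V /=.
have r1 : 1 < r by near: r; apply: nbhs_pinfty_gt.
have r0 : 0 < r by lra.
rewrite le_decay_rate// le_normalized//.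
apply: (@le_trans _ _ (K * r `^ (d%:R - u))%:E); first by near: r.
have -> : d%:R + - ((theta * u - e) / theta) = e / theta + (d%:R - u).
  by field; rewrite gt_eqF.
rewrite lee_fin [leRHS]powRD ?(gt_eqF r0) ?implybT// ler_pM2r ?powR_gt0//.
(* What remains is [K <= r ^ (e / theta)], true once [r >= expR ((e / theta)^-1 * ln K)]. *)
rewrite -ler_ln ?posrE ?powR_gt0// ln_powR -ler_pdivrMl ?divr_gt0//.
rewrite -ler_expR lnK ?posrE//; near: r; apply: nbhs_pinfty_ge.
Unshelve. all: by end_near. Qed.

Lemma lower_rate_lt t : (t%:E < limf_einf rate (pinfty_nbhs R))%E ->
  exists2 r0, 1 < r0 &
    forall r, r0 <= r -> (I r <= (r `^ (d%:R - t / theta))%:E)%E.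
Proof.
rewrite limf_einfE => /ereal_sup_gt[_ [V [M [Mreal MV]] <-]] /ltW tV.
(* The neighbourhood [V] is only known to contain the points strictly above [M]; the 2 ensures
   [r > 1], so that [ln r > 0]. *)
exists (Num.max 2 (M + 1)); first by rewrite lt_max ltr1n.
move=> r; rewrite ge_max => /andP[r2 rM].
have r1 : 1 < r by lra.
rewrite -le_normalized; last lra.
rewrite -le_decay_rate//; apply: (le_trans tV).
by apply: ereal_inf_lbound; exists r => //; apply: MV; lra.
Qed.

End rate.
End growth.

(** * Countable covers, geometric series and dyadic scales *)

Section auxiliary.
Context {R : realType}.

(** Countable subadditivity, by making the cover disjoint. The sets may overlap and may miss zeros
    of [h]; this allows closed shells that do not reach the origin. *)
Lemma ge0_integral_cover d (T : measurableType d)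
    (mu : {measure set T -> \bar R}) (D : set T) (A : (set T)^nat)
    (h : T -> \bar R) :
  measurable D -> (forall k, measurable (A k)) ->
  measurable_fun [set: T] h -> (forall x, 0 <= h x)%E ->
  (forall x, D x -> h x != 0%E -> exists k, A k x) ->
  (\int[mu]_(x in D) h x <= \sum_(k <oo) \int[mu]_(x in A k) h x)%E.
Proof.
move=> mD mA mh h0 DA.
have mU : measurable (\bigcup_k seqDU A k).
  by rewrite -seqDU_bigcup_eq; exact: bigcupT_measurable.
have mDU k : measurable (seqDU A k).
  by apply: measurableD => //; exact: bigsetU_measurable.
apply: (@le_trans _ _ (\int[mu]_(x in \bigcup_k seqDU A k) h x)%E).
  rewrite integral_mkcond [leRHS]integral_mkcond; apply: ge0_le_integral => //.
  - by move=> x _; exact: erestrict_ge0.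
  - by apply/(measurable_restrictT _ _).1 => //; exact: measurable_funTS.
  - by apply/(measurable_restrictT _ _).1 => //; exact: measurable_funTS.
  - move=> x _; rewrite /patch; case: ifPn => [/set_mem Dx|_]; last by case: ifP.
    have [->|/(DA _ Dx)[k Akx]] := eqVneq (h x) 0%E; first by case: ifP.
    by rewrite ifT//; apply/mem_set; rewrite -seqDU_bigcup_eq; exists k.
rewrite ge0_integral_bigcup//; [|exact: measurable_funTS].
apply: lee_nneseries => [k _ _|k _]; first exact: integral_ge0.
by apply: ge0_subset_integral => //; [exact: measurable_funTS|exact: subDsetl].
Qed.

Lemma geometric_nneseries_lty (a x : R) : 0 <= a -> 0 < x -> x < 1 ->
  (\sum_(k <oo) (a * x ^+ k)%:E < +oo)%E.
Proof.
move=> a0 x0 x1.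
apply: (@le_lt_trans _ _ (a * (1 - x)^-1)%:E); last exact: ltry.
apply: lime_le.
  apply: is_cvg_nneseries => k _ _.
  by rewrite lee_fin mulr_ge0// exprn_ge0// ltW.
apply: nearW => n; rewrite sumEFin lee_fin.
by apply: geometric_le_lim => //; rewrite gtr0_norm.
Qed.

Lemma dyadic_bracket (y : R) : 1 <= y -> exists k, 2 ^+ k <= y <= 2 ^+ k.+1.
Proof.
(* Taking the integer part of [y] first is harmless, since powers of 2 are integers. *)
move=> y1; exists (trunc_log 2 (Num.truncn y)).
have t0 : (0 < Num.truncn y)%N by rewrite truncn_gt0.
have /andP[l u] := trunc_log_bounds (isT : (1 < 2)%N) t0.
have /andP[tl tu] := truncn_itv (le_trans ler01 y1).
rewrite -!natrX; apply/andP; split; first by rewrite (le_trans _ tl)// ler_nat.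
by rewrite (le_trans (ltW tu))// ler_nat.
Qed.

Lemma le0_ger_powR (p x y : R) : p <= 0 -> 0 < x -> x <= y -> y `^ p <= x `^ p.
Proof.
move=> p0 x0 xy; have y0 : 0 < y by exact: lt_le_trans xy.
by rewrite -ler_ln ?posrE ?powR_gt0// !ln_powR ler_wnM2l// ler_ln ?posrE.
Qed.

End auxiliary.

(** * Measurability of the norm and volume of balls *)

Section euclid.
Context {R : realType} {d : nat}.
Local Notation E := (euclid R d).

Definition eball (r : R) : set E := [set z | enorm z <= r].

Lemma measurable_edot : measurable_fun [set: E * E] (fun p => edot p.1 p.2).
Proof.
apply: measurable_sum => i; apply: measurable_funM.
  by apply: (measurableT_comp (measurable_tnth i)); exact: measurable_fst.
by apply: (measurableT_comp (measurable_tnth i)); exact: measurable_snd.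
Qed.

Lemma measurable_enorm : measurable_fun [set: E] (@enorm R d).
Proof.
apply: measurableT_comp.
  by apply: continuous_measurable_fun; exact: sqrt_continuous.
apply: (measurableT_comp measurable_edot (g := fun z : E => (z, z))).
by apply/measurable_fun_pair; exact: measurable_id.
Qed.

Lemma enorm_ge0 (z : E) : 0 <= enorm z. Proof. exact: sqrtr_ge0. Qed.

Lemma measurable_enorm_itv (J : interval R) :
  measurable [set z : E | enorm z \in J].
Proof.
rewrite -[X in measurable X]setTI.
exact: (measurable_enorm measurableT (measurable_itv J)).
Qed.

Lemma measurable_eball r : measurable (eball r).
Proof. exact: (measurable_enorm_itv `]-oo, r]). Qed.

Lemma coord_le_enorm (z : E) (i : 'I_d) : `|(tnth z i : R)| <= enorm z.
Proof.
rewrite -sqrtr_sqr ler_wsqrtr// /edot (bigD1 i)//= expr2 lerDl.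
by apply: sumr_ge0 => j _; rewrite -expr2 sqr_ge0.
Qed.

(** The ball lies in the cube of side [2 * r]. The case [r = 0] is kept because it makes the origin
    a null set. *)
Lemma eball_volume r : 0 <= r ->
  (euclid_lebesgue d (eball r) <= ((2 * r) ^+ d)%:E)%E.
Proof.
move=> r0.
apply: (@le_trans _ _
    (euclid_lebesgue d [set z : E | forall i, `[- r, r]%classic (tnth z i)])).
  apply: le_measure; rewrite ?inE; first exact: measurable_eball.
    rewrite (_ : [set _ | _] =
      \bigcap_(i in [set: 'I_d])
        ((fun z : E => tnth z i) @^-1` `[- r, r]%classic)).
      apply: fin_bigcap_measurable => // i _; rewrite -[X in measurable X]setTI.
      exact: measurable_tnth.
    by apply/seteqP; split => z h i => [_|]; exact: h.
  move=> z zr i /=; rewrite in_itv/= -ler_norml.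
  exact: le_trans (coord_le_enorm z i) zr.
rewrite (@euclid_lebesgue_box R d (fun=> `[- r, r]%classic))//.
rewrite (eq_bigr (fun=> (2 * r)%:E)) => [|i _].
  by rewrite prodEFin prodr_const card_ord.
rewrite lebesgue_measure_itv/= lte_fin.
case: ltP => [_|rr]; first by rewrite -EFinB; congr EFin; ring.
by congr EFin; lra.
Qed.

End euclid.

(** * Ball integrals against moments of a nonnegative density *)

Section radial_moments.
Context {R : realType} {d : nat}.
Variable f : euclid R d -> R.
Hypothesis f_ge0 : forall z, 0 <= f z.
Hypothesis measurable_f : measurable_fun [set: euclid R d] f.

Local Notation leb := (@euclid_lebesgue R d).
Local Notation ball_integral r := (\int[leb]_(z in eball r) (f z)%:E)%E.
Local Notation moment p := (\int[leb]_z (f z * enorm z `^ p)%:E)%E.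

Lemma measurable_moment_density p :
  measurable_fun [set: euclid R d] (fun z => (f z * enorm z `^ p)%:E).
Proof.
apply/measurable_EFinP/measurable_funM => //.
by apply: (measurableT_comp (measurable_powR p)); exact: measurable_enorm.
Qed.

Lemma measurable_ball_density D : measurable_fun D (fun z => (f z)%:E).
Proof. by apply/measurable_EFinP; exact: measurable_funTS. Qed.

Lemma moment_density_ge0 p z : (0 <= (f z * enorm z `^ p)%:E)%E.
Proof. by rewrite lee_fin mulr_ge0// powR_ge0. Qed.

Let f_geE z : (0 <= (f z)%:E)%E. Proof. by rewrite lee_fin. Qed.

(** On the shell from [a * q ^+ k] to [b * q ^+ k] the weight is at most [(a * q ^+ k) ^ p], as
    [p < 0]. So the shell contributes at most [a ^ p * K * b ^ e] times the [k]-th power of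
    [q ^ (p + e)]. Leaving [q] free covers both shells growing to infinity and shells shrinking to
    the origin. *)
Lemma shell_moment_lty (D : set (euclid R d)) (a b q K e p : R) :
  measurable D -> 0 < a -> 0 < b -> 0 < q -> 0 <= K -> p < 0 ->
  q `^ (p + e) < 1 ->
  (forall k, ball_integral (b * q ^+ k) <= (K * (b * q ^+ k) `^ e)%:E)%E ->
  (forall z, D z -> 0 < enorm z ->
    exists k, a * q ^+ k <= enorm z <= b * q ^+ k) ->
  (\int[leb]_(z in D) (f z * enorm z `^ p)%:E < +oo)%E.
Proof.
move=> mD a0 b0 q0 K0 p0 qlt1 bint cov.
pose A k := [set z : euclid R d | enorm z \in `[a * q ^+ k, b * q ^+ k]].
have aq k : 0 < a * q ^+ k by rewrite mulr_gt0// exprn_gt0.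
have mA k : measurable (A k) by exact: measurable_enorm_itv.
apply: (@le_lt_trans _ _
    (\sum_(k <oo) \int[leb]_(z in A k) (f z * enorm z `^ p)%:E)%E).
  apply: ge0_integral_cover => //.
  - exact: measurable_moment_density.
  - exact: moment_density_ge0.
  (* The shells miss the origin, but the density vanishes there because [0 ^ p = 0] for [p != 0]. *)
  - move=> z Dz; rewrite eqe => fz; have [|k zk] := cov z Dz.
      rewrite lt_neqAle enorm_ge0 andbT eq_sym.
      by apply: contra_neq fz => ->; rewrite powR0 ?mulr0// lt_eqF.
    by exists k; rewrite /A /= in_itv.
have := @geometric_nneseries_lty R (a `^ p * (K * b `^ e)) (q `^ (p + e)).
rewrite !mulr_ge0 ?powR_ge0//= => /(_ isT (powR_gt0 _ q0) qlt1).
apply: le_lt_trans; apply: lee_nneseries => [k _ _|k _].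
  by apply: integral_ge0 => z _; exact: moment_density_ge0.
apply: (@le_trans _ _ (((a * q ^+ k) `^ p)%:E * ball_integral (b * q ^+ k))%E).
  apply: (@le_trans _ _
      (\int[leb]_(z in A k) (((a * q ^+ k) `^ p)%:E * (f z)%:E))%E).
    apply: ge0_le_integral => //.
    - by move=> z _; exact: moment_density_ge0.
    - by apply: measurable_funTS; exact: measurable_moment_density.
    - by apply: measurable_funeM; exact: measurable_ball_density.
    - move=> z; rewrite /A /= in_itv/= => /andP[az _].
      rewrite -EFinM lee_fin mulrC ler_wpM2r//.
      by apply: le0_ger_powR => //; exact: ltW.
  rewrite ge0_integralZl//; last by rewrite lee_fin powR_ge0.
    apply: lee_wpmul2l; first by rewrite lee_fin powR_ge0.
    apply: ge0_subset_integral => //.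
    - exact: measurable_eball.
    - exact: measurable_ball_density.
    - by move=> z; rewrite /A /= in_itv/= => /andP[].
  exact: measurable_ball_density.
apply: (@le_trans _ _
    (((a * q ^+ k) `^ p)%:E * (K * (b * q ^+ k) `^ e)%:E)%E).
  by apply: lee_wpmul2l => //; rewrite lee_fin powR_ge0.
have qk s : (q ^+ k) `^ s = (q `^ s) ^+ k.
  by rewrite -!powR_mulrn ?powR_ge0 ?ltW// -!powRrM mulrC.
rewrite -EFinM lee_fin !powRM ?exprn_ge0 ?(ltW a0) ?(ltW b0) ?(ltW q0)// !qk.
rewrite [q `^ (p + e)]powRD ?(gt_eqF q0) ?implybT// exprMn.
by rewrite le_eqVlt; apply/orP; left; apply/eqP; ring.
Qed.

(** The moment is cut at radius [r0]. Inside, the volume bound has exponent [d] and the shells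
    converge because [p + d > 0]; outside, the decay exponent [e] is used and they converge because
    [p + e < 0]. *)
Lemma moment_lty (r0 K M e p : R) : 0 < r0 -> 0 <= K -> 0 <= M ->
  p < 0 -> p + e < 0 -> 0 < p + d%:R ->
  (forall r, (r0 <= r)%R -> ball_integral r <= (K * r `^ e)%:E)%E ->
  (forall r, (0 < r)%R -> ball_integral r <= (M * r ^+ d)%:E)%E ->
  (moment p < +oo)%E.
Proof.
move=> r00 K0 M0 p0 pe pd large small.
have q0 : 0 < 2^-1 :> R by lra.
have mB : measurable (eball r0 : set (euclid R d)) by exact: measurable_eball.
have mC : measurable (~` eball r0 : set (euclid R d)) by exact: measurableC.
rewrite -(setUv (eball r0)) ge0_integral_setU//; last 3 first.
- by apply: measurable_funTS; exact: measurable_moment_density.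
- by move=> z _; exact: moment_density_ge0.
- by apply/disj_setPCl.
apply: lte_add_pinfty.
(* Shells halve towards the origin; the index of [z] is found by bracketing [r0 / enorm z]. *)
- apply: (@shell_moment_lty _ (r0 / 2) r0 2^-1 M d%:R) => //.
  + by lra.
  + rewrite -ltr_ln ?posrE ?powR_gt0// ln1 ln_powR lnV ?posrE// mulrN.
    by rewrite oppr_lt0 mulr_gt0// ln_gt0// ltr1n.
  + move=> k; rewrite powR_mulrn; last by rewrite mulr_ge0 ?exprn_ge0 ?ltW.
    by apply: small; rewrite mulr_gt0// exprn_gt0.
  + move=> z zr0 z0.
    have [|k /andP[lk ku]] := @dyadic_bracket R (r0 / enorm z).
      by rewrite ler_pdivlMr// mul1r.
    exists k; rewrite !exprVn; apply/andP; split.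
      rewrite -mulrA -invfM -exprS ler_pdivrMr ?exprn_gt0//.
      by rewrite mulrC -ler_pdivrMr.
    by rewrite ler_pdivlMr ?exprn_gt0// mulrC -ler_pdivlMr.
(* Shells double towards infinity; the index of [z] is found by bracketing [enorm z / r0]. *)
- apply: (@shell_moment_lty _ r0 (2 * r0) 2 K e) => //.
  + by lra.
  + rewrite -ltr_ln ?posrE ?powR_gt0// ln1 ln_powR nmulr_rlt0//.
    by rewrite ln_gt0// ltr1n.
  + move=> k; apply: large.
    have -> : 2 * r0 * 2 ^+ k = r0 * 2 ^+ k.+1 by rewrite exprS; ring.
    by rewrite ler_peMr ?(ltW r00)// exprn_ege1// ler1n.
  + move=> z /negP; rewrite -ltNge => /ltW zr0 z0.
    have [|k /andP[lk ku]] := @dyadic_bracket R (enorm z / r0).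
      by rewrite ler_pdivlMr// mul1r.
    exists k; rewrite -ler_pdivlMl// mulrC lk/=.
    by rewrite mulrAC mulrC -exprS// -ler_pdivrMl// mulrC.
Qed.

(** In dimension 0 the measure is a Dirac mass and the origin is not null. *)
Lemma eball0_null : (0 < d)%N -> leb (eball 0) = 0%E.
Proof.
move=> d0; apply/eqP; rewrite eq_le measure_ge0 andbT.
by have := @eball_volume R d 0 (lexx _); rewrite mulr0 expr0n gtn_eqF.
Qed.

(** A Chebyshev bound: [1 <= r ^ (- p) * enorm z ^ p] for [0 < enorm z <= r] and [p <= 0]. *)
Lemma ball_integral_le_moment (r p : R) : (0 < d)%N -> 0 < r -> p <= 0 ->
  (ball_integral r <= (r `^ (- p))%:E * moment p)%E.
Proof.
move=> d0 r0 p0.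
have mB s : measurable (eball s : set (euclid R d)) by exact: measurable_eball.
(* The origin has to be removed since 0 `^ p = 0 for p < 0. *)
rewrite (@ge0_negligible_integral _ _ _ _ _ (eball 0))//; last 2 first.
- exact: measurable_ball_density.
- exact: eball0_null.
rewrite powRN lee_pdivlMl ?powR_gt0// -ge0_integralZl//; last 3 first.
- exact: measurableD.
- exact: measurable_ball_density.
- by rewrite lee_fin powR_ge0.
apply: (@le_trans _ _ (\int[leb]_(z in eball r `\` eball 0)
    (f z * enorm z `^ p)%:E)%E).
  apply: ge0_le_integral => //.
  - exact: measurableD.
  - by move=> z _; rewrite -EFinM lee_fin mulr_ge0// powR_ge0.
  - by apply: measurable_funeM; exact: measurable_ball_density.
  - by apply: measurable_funTS; exact: measurable_moment_density.
  - move=> z [zr /negP]; rewrite -ltNge => z0.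
    by rewrite -EFinM lee_fin mulrC ler_wpM2l// le0_ger_powR.
apply: ge0_subset_integral => //; first exact: measurableD.
- exact: measurable_moment_density.
- by move=> z _; exact: moment_density_ge0.
Qed.

(** For [p >= 0] the weight is at least 1 off the unit ball, so the moment controls the tail of [f]
    uniformly in [r]. *)
Lemma ball_integral_le_moment_ge0 (r p : R) : 0 <= p ->
  (ball_integral r <= ball_integral 1 + moment p)%E.
Proof.
move=> p0.
have mB s : measurable (eball s : set (euclid R d)) by exact: measurable_eball.
have mC : measurable (~` eball 1 : set (euclid R d)) by exact: measurableC.
apply: (@le_trans _ _ (\int[leb]_z (f z)%:E)%E).
  by apply: ge0_subset_integral => //; exact: measurable_ball_density.
rewrite -(setUv (eball 1)) ge0_integral_setU//; last 2 first.
- exact: measurable_ball_density.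
- by apply/disj_setPCl.
rewrite leeD2l// setUv.
apply: (@le_trans _ _ (\int[leb]_(z in ~` eball 1)
    (f z * enorm z `^ p)%:E)%E).
  apply: ge0_le_integral => //.
  - exact: measurable_ball_density.
  - by apply: measurable_funTS; exact: measurable_moment_density.
  - move=> z /negP; rewrite -ltNge => /ltW z1.
    rewrite lee_fin ler_peMr//.
    have -> : 1 = 1 `^ p by rewrite powR1.
    by rewrite ge0_ler_powR// nnegrE// enorm_ge0.
apply: ge0_subset_integral => //; first exact: measurable_moment_density.
by move=> z _; exact: moment_density_ge0.
Qed.

End radial_moments.

(** * Measurability and boundedness of the Fourier transform *)

Section fourier_regularity.
Context {R : realType} {d : nat}.
Variable mu : {finite_measure set (euclid R d) -> \bar R}.
Local Notation E := (euclid R d).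
Local Notation normc := ComplexField.Normc.normc.

Section oscillatory_integral.
Variable g : R -> R.
Hypothesis measurable_g : measurable_fun [set: R] g.
Hypothesis g_le1 : forall t, `|g t| <= 1.

Local Notation phase z x := (- (2 * pi * edot z x)).

Let measurable_g_phase :
  measurable_fun [set: E * E] (fun p => g (phase p.1 p.2)).
Proof.
apply: (measurableT_comp measurable_g).
apply: measurable_funN.
by apply: measurable_funM => //; exact: measurable_edot.
Qed.

Let measurable_g_phase2 (z : E) :
  measurable_fun [set: E] (fun x => g (phase z x)).
Proof.
exact: (measurableT_comp measurable_g_phase (pair1_measurable z)).
Qed.

Let integrable_g_phase (z : E) :
  mu.-integrable [set: E] (EFin \o (fun x => g (phase z x))).
Proof.
apply: measurable_bounded_integrable => //; first exact: fin_num_fun_lty.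
by exists 1; split => // M M1 x _ /=; rewrite (le_trans (g_le1 _))// ltW.
Qed.

Let integrable_cst (c : R) : mu.-integrable [set: E] (EFin \o (fun=> c)).
Proof. exact: finite_measure_integrable_cst. Qed.

(** With [g] equal to [cos] or [sin] this is the real or imaginary part of the Fourier transform. *)
Lemma measurable_oscillatory_integral :
  measurable_fun [set: E] (fun z => \int[mu]_x g (phase z x)).
Proof.
(* Adding 1 makes the integrand nonnegative, so that Tonelli's measurability
   result applies. *)
pose h (p : E * E) : \bar R := (1 + g (phase p.1 p.2))%:E.
have mh : measurable_fun [set: E * E] h.
  by apply/measurable_EFinP; exact: measurable_funD.
have h0 p : (0 <= h p)%E.
  by have := g_le1 (phase p.1 p.2); rewrite lee_fin ler_norml; lra.
have mF := @measurable_fun_fubini_tonelli_F _ _ _ _ _ mu h mh h0.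
rewrite (_ : (fun z => _) =
    (fun z => fine (fubini_F mu h z) - fine (mu [set: E]))).
  by apply: measurable_funB => //; exact: measurableT_comp.
apply/funext => z.
rewrite -[fine (fubini_F mu h z)]/(\int[mu]_x (1 + g (phase z x))).
rewrite RintegralD// Rintegral_cst// mul1r; ring.
Qed.

Lemma oscillatory_integral_le (z : E) :
  `|\int[mu]_x g (phase z x)| <= fine (mu [set: E]).
Proof.
apply: le_trans (le_normr_Rintegral _ _) _ => //.
rewrite -[leRHS]mul1r -Rintegral_cst//; apply: le_Rintegral => //.
exact: integrable_norm.
Qed.

End oscillatory_integral.

Lemma measurable_norm_fourier :
  measurable_fun [set: E] (fun z => normc (fourier mu z)).
Proof.
rewrite /fourier /Cintegral /=.
apply: measurableT_comp.
  exact: continuous_measurable_fun (@sqrt_continuous R).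
apply: measurable_funD; apply: measurable_funX.
  apply: measurable_oscillatory_integral => [|t]; last exact: cos_max.
  exact: continuous_measurable_fun (@continuous_cos R).
apply: measurable_oscillatory_integral => [|t]; last exact: sin_max.
exact: continuous_measurable_fun (@continuous_sin R).
Qed.

Lemma norm_fourier_ge0 z : 0 <= normc (fourier mu z).
Proof. exact: sqrtr_ge0. Qed.

(** Bounding real and imaginary parts separately costs the factor 2; only boundedness matters
    later. *)
Lemma norm_fourier_le z : normc (fourier mu z) <= 2 * fine (mu [set: E]).
Proof.
rewrite /fourier /Cintegral /=.
have := oscillatory_integral_le (continuous_measurable_fun (@continuous_cos R))
  (@cos_max R) z.
have := oscillatory_integral_le (continuous_measurable_fun (@continuous_sin R))
  (@sin_max R) z.
set a := Rintegral _ _ _; set b := Rintegral _ _ _ => aM bM.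
set M := fine _ in aM bM *.
have M0 : 0 <= M by exact: le_trans (normr_ge0 _) aM.
rewrite -(@ger0_norm _ (2 * M)) ?mulr_ge0// -sqrtr_sqr ler_wsqrtr//.
move: aM bM; rewrite !ler_norml => /andP[a1 a2] /andP[b1 b2].
nra.
Qed.

End fourier_regularity.

Theorem theorem4p2 (R : realType) (d : nat)
    (mu : {finite_measure set (euclid R d) -> \bar R}) (theta : R)
    (mu_neq0 : mu [set: euclid R d] != 0%E)
    (theta_gt0 : 0 < theta) (theta_le1 : theta <= 1)
    (F_lt : (lower_F mu theta < (theta * d%:R)%:E)%E) :
  fourier_spectrum mu theta = lower_F mu theta.
Proof.
pose f z := ComplexField.Normc.normc (fourier mu z) `^ (2 / theta).
have f_ge0 z : 0 <= f z by exact: powR_ge0.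
have mf : measurable_fun [set: euclid R d] f.
  apply: (measurableT_comp (measurable_powR _)).
  exact: measurable_norm_fourier.
pose I r := (\int[euclid_lebesgue d]_(z in eball r) (f z)%:E)%E.
pose C := (2 * fine (mu [set: euclid R d])) `^ (2 / theta).
have C0 : 0 <= C by exact: powR_ge0.
have fC z : f z <= C.
  rewrite ge0_ler_powR ?divr_ge0 ?(ltW theta_gt0) ?nnegrE ?norm_fourier_ge0
    ?norm_fourier_le//.
  exact: le_trans (norm_fourier_ge0 mu z) (norm_fourier_le mu z).
have small r : 0 < r -> (I r <= (C * 2 ^+ d * r ^+ d)%:E)%E.
  move=> r0; apply: (@le_trans _ _
      (\int[euclid_lebesgue d]_(z in eball r) (cst C%:E z))%E).
    apply: ge0_le_integral => //.
    - exact: measurable_eball.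
    - by move=> z _; rewrite lee_fin.
    - exact: measurable_ball_density.
    - by move=> z _; rewrite lee_fin.
  rewrite integral_cst; last exact: measurable_eball.
  rewrite -mulrA -exprMn EFinM; apply: lee_wpmul2l; first by rewrite lee_fin.
  exact/eball_volume/ltW.
have I_F K u : 0 < K ->
    (forall r, (1 < r)%R -> I r <= (K * r `^ (d%:R - u))%:E)%E ->
    ((theta * u)%:E <= lower_F mu theta)%E.
  move=> K0 IK; apply: (@lower_rate_ge R d theta I theta_gt0 K) => //.
  by near=> r; apply: IK; near: r; exact: nbhs_pinfty_gt.
(* The volume bound is the case [u = 0]; adding 1 makes the constant positive. Nonnegativity matches
   the maximum with 0 in [fourier_spectrum] and, with [F_lt], forces [d > 0]. *)
have F0 : (0 <= lower_F mu theta)%E.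
  rewrite -[0%E]/(0%:E) -(mulr0 theta); apply: (I_F (C * 2 ^+ d + 1)).
    by rewrite ltr_wpDl// mulr_ge0// exprn_ge0.
  move=> r r1; have r0 : 0 < r by lra.
  rewrite (le_trans (small r r0))// subr0 powR_mulrn ?(ltW r0)// lee_fin.
  by rewrite ler_wpM2r ?exprn_ge0 ?(ltW r0)// lerDl.
have d0 : (0 < d)%N.
  rewrite -(@ltr0n R) -(pmulr_rgt0 _ theta_gt0) -lte_fin.
  exact: le_lt_trans F_lt.
have energyP s : (fourier_energy mu s theta < +oo)%E <->
    (\int[euclid_lebesgue d]_z
      (f z * enorm z `^ (s / theta - d%:R))%:E < +oo)%E.
  split; last exact: poweR_lty.
  by apply: lty_poweRy; rewrite gt_eqF.
apply/eqP; rewrite eq_le; apply/andP; split.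
  rewrite /fourier_spectrum ge_max F0/=.
  apply: ge_ereal_sup => _ [s [s0 /energyP sfin] <-].
  set J := integral _ _ _ in sfin.
  have J0 : (0 <= J)%E.
    by apply: integral_ge0 => z _; exact: moment_density_ge0.
  have fJ : J = (fine J)%:E by rewrite fineK// ge0_fin_numE.
  (* The cases are the two signs of the exponent [s / theta - d%:R]. *)
  have [sd|ds] := leP s (theta * d%:R).
    rewrite (_ : s = theta * (s / theta)); last by field; rewrite gt_eqF.
    apply: (I_F (fine J + 1)).
      by rewrite ltr_wpDl// fine_ge0.
    move=> r r1; have r0 : 0 < r by lra.
    have p0 : s / theta - d%:R <= 0.
      by rewrite subr_le0 ler_pdivrMr// mulrC.
    apply: le_trans (ball_integral_le_moment f_ge0 mf d0 r0 p0) _.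
    rewrite -/J fJ opprB -EFinM lee_fin mulrC ler_wpM2r ?powR_ge0//.
    by rewrite lerDl.
  suff : ((theta * d%:R)%:E <= lower_F mu theta)%E by rewrite leNgt F_lt.
  have I1 : (I 1%R < +oo)%E by apply: le_lt_trans (small 1 ltr01) (ltry _).
  have I10 : (0 <= I 1%R)%E by apply: integral_ge0 => z _; rewrite lee_fin.
  (* Here [I] is bounded, which is the power bound with [u = d]. *)
  apply: (I_F (fine (I 1%R + J)%E + 1)).
    by rewrite ltr_wpDl// fine_ge0// adde_ge0.
  move=> r r1; rewrite subrr powRr0 mulr1.
  have p0 : 0 <= s / theta - d%:R.
    by rewrite subr_ge0 ler_pdivlMr// mulrC ltW.
  apply: le_trans (ball_integral_le_moment_ge0 f_ge0 mf r p0) _.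
  rewrite -/J -/(I 1) EFinD fineK; first by rewrite leeDl.
  by rewrite ge0_fin_numE; [exact: lte_add_pinfty|exact: adde_ge0].
(* By contradiction: an [s] strictly above the spectrum with finite energy is produced. Both
   quantities are first shown finite, so that midpoints make sense. *)
rewrite leNgt; apply/negP => GF.
have G0 : (0 <= fourier_spectrum mu theta)%E by rewrite le_max lexx.
have Ffin : lower_F mu theta \is a fin_num.
  by rewrite ge0_fin_numE// (lt_trans F_lt)// ltry.
have Gfin : fourier_spectrum mu theta \is a fin_num.
  by rewrite ge0_fin_numE// (lt_trans GF)// -ge0_fin_numE.
move: GF G0 F_lt; rewrite -(fineK Ffin) -(fineK Gfin) !lte_fin lee_fin.
set a := fine (lower_F mu theta); set b := fine (fourier_spectrum mu theta).
move=> ba b0 ad.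
(* Now [b < s < t < a]: the gap up to [t] makes the series at infinity converge, and [s > b >= 0]
   the one at the origin. *)
pose s := (b + a) / 2; pose t := (s + a) / 2.
have bs : b < s by rewrite /s; lra.
have st : s < t by rewrite /t /s; lra.
have ta : t < a by rewrite /t /s; lra.
have [|r0 r01 large] := @lower_rate_lt R d theta I theta_gt0 t.
  by rewrite (_ : limf_einf _ _ = a%:E) ?lte_fin// /a fineK.
suff : (s%:E <= fourier_spectrum mu theta)%E.
  by rewrite -(fineK Gfin) lee_fin leNgt bs.
rewrite le_max; apply/orP; right; apply: ereal_sup_ubound.
exists s => //; split; first lra.
apply/energyP; apply: (@moment_lty R d f f_ge0 mf r0 1 (C * 2 ^+ d)
  (d%:R - t / theta)) => //.
- lra.
- by rewrite mulr_ge0// exprn_ge0.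
- rewrite subr_lt0 ltr_pdivrMr// mulrC; lra.
- have -> : s / theta - d%:R + (d%:R - t / theta) = (s - t) / theta by ring.
  by rewrite pmulr_llt0 ?invr_gt0// subr_lt0.
- by rewrite subrK divr_gt0//; lra.
- by move=> r rr; rewrite mul1r; exact: large.
Unshelve. all: by end_near. Qed.
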